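(* Let $a>0,\ b>0,\ c>0$ and put $$\Phi(x)={}_1F_2\left[\begin{array}{c} a\\ b,\ c\end{array}\biggr|\,-\frac{x^2}{4}\right]\qquad(x>0).$$ Let $\Lambda=\left\{\left(a+\tfrac12,\,2a\right),\ \left(2a,\,a+\tfrac12\right)\right\}$ and let $P_a^*$ be the set of pairs $(b,c)$ of positive real numbers defined by $$P_a^*=\left\{b>a,\ c>a,\ c\ge\max\left[3a+\frac12-b,\ \ a+\frac{a}{2(b-a)}\right]\right\}.$$ If $(b,c)\in P_a^*\setminus\Lambda$, then $\Phi$ is strictly positive, i.e. $\Phi(x)>0$ for all $x>0$.
   Context: For real $\alpha$, the Pochhammer symbol is $(\alpha)_0=1$ and $(\alpha)_k=\alpha(\alpha+1)\cdots(\alpha+k-1)$ for $k\ge1$. The generalized hypergeometric function ${}_1F_2$ is $${}_1F_2\left[\begin{array}{c} a\\ b,\ c\end{array}\biggr|\,z\right]=\sum_{k=0}^\infty\frac{(a)_k}{k!\,(b)_k(c)_k}\,z^k .$$ *)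

(* Defs.v *)
From Stdlib Require Import Arith Factorial Reals.
From Coquelicot Require Import Coquelicot.
Open Scope R_scope.

Fixpoint pochhammer (alpha : R) (k : nat) : R :=
  match k with
  | O => 1
  | S j => pochhammer alpha j * (alpha + INR j)
  end.

(* [PSeries] is total; for b, c > 0 the radius of convergence is infinite,
   so it is the genuine sum for every real z. *)
Definition hyp1F2 (a b c z : R) : R :=
  PSeries (fun k => pochhammer a k
                    / (INR (fact k) * pochhammer b k * pochhammer c k)) z.

Definition Phi (a b c x : R) : R := hyp1F2 a b c (- (x ^ 2 / 4)).

Definition Lambda (a : R) (p : R * R) : Prop :=
  p = (a + 1 / 2, 2 * a) \/ p = (2 * a, a + 1 / 2).

Definition P_star (a : R) (p : R * R) : Prop :=
  let (b, c) := p in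
  0 < b /\ 0 < c /\ b > a /\ c > a /\
  c >= Rmax (3 * a + 1 / 2 - b) (a + a / (2 * (b - a))).

(* Main.v *)
Require Import Defs.
From Stdlib Require Import Reals Lra Lia Factorial.
From Coquelicot Require Import Coquelicot.
Open Scope R_scope.

(** The function [Phi] is written as a sum of squares of Bessel functions with
    nonnegative coefficients.  Put [u = b - a], [v = c - a],
    [mu = (b + c - a - 1/2) / 2], [t = mu + 1/2], [y = x^2 / 16] and let
    [f_s(y) = sum_k (-y)^k / (k! (s)_k)], a normalised Bessel function.  In terms
    of [u] and [v] the hypotheses say [mu >= a] and [u v >= a/2].

    Neumann's formula gives the Taylor coefficients of [f_s^2]
    ([is_pseries_bessel_sq]), and a classical inverse pair ([weight_inversion])
    turns any power series in [y] into a series in [y^n f_{t+n}(y)^2].  This is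
    Gasper's method; for [Phi] the coefficients are positive multiples of
    [C_n = 4F3(-n, n+2mu-1, mu+1/2, a; mu, b, c; 1)].  The value of [mu] is the
    one that makes this series balanced, so Whipple's transformation, obtained
    by applying Saalschutz's theorem twice ([square_coef_whipple]), shows that
    [C_n] is a positive multiple of
    [S_n = sum_{i+j=n} C(n,i) (-1/2)_i p_i q_j], where [p_i = (a)_i / (mu)_i] and
    [q_j = (u)_j (v)_j / (mu)_j]; these are [sign_sum] and [growth].

    Only the term [i = 0] of [S_n] is positive.  If [p_i] is replaced by [1] and
    [q_j] by [(1/2)_j], which is the case [u v = a/2], [mu = a] of [Lambda], the
    sum vanishes for [n >= 1] by Vandermonde's formula.  In general [q_j] grows at
    least as fast as [(1/2)_j] from [j = 1] on, and a loss at [j = 0] is made up for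
    by [p_n], so the negative terms weigh relatively less and [S_n >= 0]
    ([sign_sum_nonneg]).  Moreover [S_0 = 1] and, outside [Lambda],
    [S_1 > 0] or [S_2 > 0].

    For strict positivity it remains to see that [f_t] has no positive zero in
    common with [f_{t+1}] or with [f_{t+2}].  A zero common to two of these three
    functions is, by the contiguous relation, a zero of every [f_{t+n}], whereas
    [f_{t+n}(y)] tends to [1] ([bessel_no_common_zero]). *)

(** * Rising factorials *)

Lemma poch_add (x : R) (i j : nat) :
  pochhammer x (i + j) = pochhammer x i * pochhammer (x + INR i) j.
Proof.
induction j as [|j IH].
- rewrite Nat.add_0_r; simpl; ring.
- rewrite Nat.add_succ_r; cbn [pochhammer]; rewrite IH, plus_INR; ring.
Qed.

Lemma poch_S_l (x : R) (j : nat) :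
  pochhammer x (S j) = x * pochhammer (x + 1) j.
Proof.
change (S j) with (1 + j)%nat; rewrite poch_add; simpl.
now replace (1 * (x + 0)) with x by ring.
Qed.

Lemma poch_pos (x : R) (n : nat) : 0 < x -> 0 < pochhammer x n.
Proof.
intros hx; induction n as [|n IH]; simpl; [lra|].
pose proof (pos_INR n); apply Rmult_lt_0_compat; lra.
Qed.

Lemma poch_le (x y : R) (n : nat) :
  0 < x -> x <= y -> pochhammer x n <= pochhammer y n.
Proof.
intros hx hxy; induction n as [|n IH]; simpl; [lra|].
pose proof (pos_INR n); pose proof (poch_pos x n hx).
apply Rmult_le_compat; lra.
Qed.

Lemma pow_le_poch (x : R) (n : nat) : 0 < x -> x ^ n <= pochhammer x n.
Proof.
intros hx; induction n as [|n IH]; simpl; [lra|].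
pose proof (pos_INR n); pose proof (pow_lt x n hx).
rewrite (Rmult_comm x); apply Rmult_le_compat; lra.
Qed.

Lemma poch_reflect (x : R) (n : nat) :
  pochhammer (1 - x - INR n) n = (-1) ^ n * pochhammer x n.
Proof.
induction n as [|n IH]; [simpl; ring|].
rewrite poch_S_l.
replace (1 - x - INR (S n) + 1) with (1 - x - INR n) by (rewrite S_INR; ring).
rewrite IH, S_INR; cbn [pochhammer pow]; ring.
Qed.

Lemma poch_duplication (x : R) (n : nat) :
  pochhammer (2 * x) (2 * n) = 4 ^ n * pochhammer x n * pochhammer (x + 1 / 2) n.
Proof.
induction n as [|n IH]; [simpl; ring|].
replace (2 * S n)%nat with (S (S (2 * n))) by lia.
cbn [pochhammer pow]; rewrite IH, S_INR, mult_INR; simpl (INR 2); field.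
Qed.

(** * Binomial sums *)

(** The binomial sum of the products [C(n,i) * F i j] over [i + j = n].  Taking
    Pascal's rule as the definition makes every identity below an induction
    without factorials, divisions or subtraction of indices. *)
Fixpoint bsum (n : nat) (F : nat -> nat -> R) : R :=
  match n with
  | O => F O O
  | S p => bsum p (fun i j => F i (S j)) + bsum p (fun i j => F (S i) j)
  end.

Lemma bsum_ext (n : nat) (F G : nat -> nat -> R) :
  (forall i j, (i + j = n)%nat -> F i j = G i j) -> bsum n F = bsum n G.
Proof.
revert F G; induction n as [|n IH]; intros F G h; simpl; [now apply h|].
f_equal; apply IH; intros i j hij; apply h; lia.
Qed.

Lemma bsum_le (n : nat) (F G : nat -> nat -> R) :
  (forall i j, (i + j = n)%nat -> F i j <= G i j) -> bsum n F <= bsum n G.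
Proof.
revert F G; induction n as [|n IH]; intros F G h; simpl; [now apply h|].
apply Rplus_le_compat; apply IH; intros i j hij; apply h; lia.
Qed.

Lemma bsum_plus (n : nat) (F G : nat -> nat -> R) :
  bsum n (fun i j => F i j + G i j) = bsum n F + bsum n G.
Proof.
revert F G; induction n as [|n IH]; intros F G; simpl; [easy|].
rewrite !IH; ring.
Qed.

Lemma bsum_scal (n : nat) (x : R) (F : nat -> nat -> R) :
  bsum n (fun i j => x * F i j) = x * bsum n F.
Proof.
revert F; induction n as [|n IH]; intros F; simpl; [easy|].
rewrite !IH; ring.
Qed.

Lemma bsum_0 (n : nat) : bsum n (fun _ _ => 0) = 0.
Proof. induction n as [|n IH]; simpl; lra. Qed.

Lemma bsum_1 (n : nat) : bsum n (fun _ _ => 1) = 2 ^ n.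
Proof. induction n as [|n IH]; simpl; lra. Qed.

Lemma bsum_le_first (n : nat) (F : nat -> nat -> R) :
  (forall i j, F (S i) j <= 0) -> bsum n F <= F O n.
Proof.
revert F; induction n as [|n IH]; intros F h; simpl; [lra|].
assert (h1 : bsum n (fun i j => F i (S j)) <= F O (S n)).
{ apply (IH (fun i j => F i (S j))); intros; apply h. }
assert (h2 : bsum n (fun i j => F (S i) j) <= 0).
{ rewrite <- (bsum_0 n); apply bsum_le; intros; apply h. }
lra.
Qed.

Lemma bsum_last (n : nat) (F : nat -> nat -> R) :
  (forall i j, F i (S j) = 0) -> bsum n F = F n O.
Proof.
revert F; induction n as [|n IH]; intros F h; simpl; [easy|].
rewrite (IH (fun i j => F (S i) j)) by (intros; apply h).
rewrite (bsum_ext n _ (fun _ _ => 0)) by (intros; apply h).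
rewrite bsum_0; ring.
Qed.

(** Both sides run over the trinomial coefficients of [i + j + r = n]. *)
Lemma bsum_assoc (n : nat) (F : nat -> nat -> nat -> R) :
  bsum n (fun k r => bsum k (fun i j => F i j r)) =
  bsum n (fun i s => bsum s (fun j r => F i j r)).
Proof.
revert F; induction n as [|n IH]; intros F; simpl; [easy|].
rewrite !bsum_plus.
rewrite (IH (fun i j r => F i j (S r))), (IH (fun i j r => F i (S j) r)),
  (IH (fun i j r => F (S i) j r)); ring.
Qed.

(** [j * C(n,j) = n * C(n-1,j-1)]. *)
Lemma bsum_absorb_r (n : nat) (G : nat -> nat -> R) :
  bsum (S n) (fun i j => INR j * G i (pred j)) = INR (S n) * bsum n G.
Proof.
revert G; induction n as [|n IH]; intros G; [simpl; ring|].
change (bsum (S n) (fun i j => INR (S j) * G i j)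
        + bsum (S n) (fun i j => INR j * G (S i) (pred j))
        = INR (S (S n)) * bsum (S n) G).
rewrite (IH (fun i j => G (S i) j)).
rewrite (bsum_ext (S n) (fun i j => INR (S j) * G i j)
          (fun i j => G i j + INR j * G i (S (pred j)))).
2:{ intros i [|j] _; rewrite S_INR; simpl pred; [simpl INR|]; ring. }
rewrite bsum_plus, (IH (fun i j => G i (S j))).
rewrite (S_INR (S n)); cbn [bsum]; ring.
Qed.

Lemma bsum_absorb_l (n : nat) (G : nat -> nat -> R) :
  bsum (S n) (fun i j => INR i * G (pred i) j) = INR (S n) * bsum n G.
Proof.
revert G; induction n as [|n IH]; intros G; [simpl; ring|].
change (bsum (S n) (fun i j => INR i * G (pred i) (S j))
        + bsum (S n) (fun i j => INR (S i) * G i j)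
        = INR (S (S n)) * bsum (S n) G).
rewrite (IH (fun i j => G i (S j))).
rewrite (bsum_ext (S n) (fun i j => INR (S i) * G i j)
          (fun i j => G i j + INR i * G (S (pred i)) j)).
2:{ intros [|i] j _; rewrite S_INR; simpl pred; [simpl INR|]; ring. }
rewrite bsum_plus, (IH (fun i j => G (S i) j)).
rewrite (S_INR (S n)); cbn [bsum]; ring.
Qed.

(** The bridge to the sums occurring in products of power series.  Splitting
    [n + 1 = (n + 1 - i) + i] in each term reproduces Pascal's rule. *)
Lemma sum_bsum (n : nat) (F : nat -> nat -> R) :
  sum_f_R0 (fun i => F i (n - i)%nat / (INR (fact i) * INR (fact (n - i)))) n =
  bsum n F / INR (fact n).
Proof.
revert F; induction n as [|n IH]; intros F; [simpl; field|].
pose proof (fun k => not_0_INR _ (fact_neq_0 k)) as hf.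
assert (hn : INR (S n) <> 0) by (apply not_0_INR; lia).
apply Rmult_eq_reg_l with (INR (S n)); [|exact hn].
assert (h1 : sum_f_R0 (fun i => INR (S n - i) *
    (F i (S n - i)%nat / (INR (fact i) * INR (fact (S n - i))))) (S n)
    = bsum n (fun i j => F i (S j)) / INR (fact n)).
{ cbn [sum_f_R0]; rewrite Nat.sub_diag; simpl (INR 0).
  rewrite Rmult_0_l, Rplus_0_r, <- IH.
  apply sum_eq; intros i hi.
  replace (S n - i)%nat with (S (n - i)) by lia.
  rewrite (fact_simpl (n - i)), mult_INR.
  assert (INR (S (n - i)) <> 0) by (apply not_0_INR; lia).
  field; auto. }
assert (h2 : sum_f_R0 (fun i => INR i *
    (F i (S n - i)%nat / (INR (fact i) * INR (fact (S n - i))))) (S n)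
    = bsum n (fun i j => F (S i) j) / INR (fact n)).
{ rewrite decomp_sum by lia; simpl (INR 0).
  rewrite Rmult_0_l, Rplus_0_l, <- IH; simpl pred.
  apply sum_eq; intros i hi.
  replace (S n - S i)%nat with (n - i)%nat by lia.
  rewrite (fact_simpl i), mult_INR.
  assert (INR (S i) <> 0) by (apply not_0_INR; lia).
  field; auto. }
rewrite scal_sum.
rewrite (sum_eq _ (fun i => INR (S n - i) *
    (F i (S n - i)%nat / (INR (fact i) * INR (fact (S n - i)))) + INR i *
    (F i (S n - i)%nat / (INR (fact i) * INR (fact (S n - i)))))).
2:{ intros i hi; rewrite minus_INR by lia; ring. }
rewrite sum_plus, h1, h2, (fact_simpl n), mult_INR; cbn [bsum].
field; auto.
Qed.

(** * Summation theorems *)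

Lemma vandermonde (x y : R) (n : nat) :
  bsum n (fun i j => pochhammer x i * pochhammer y j) = pochhammer (x + y) n.
Proof.
induction n as [|n IH]; [simpl; ring|].
cbn [bsum]; rewrite <- bsum_plus.
rewrite (bsum_ext n _ (fun i j =>
  (x + y + INR n) * (pochhammer x i * pochhammer y j))).
- rewrite bsum_scal, IH; simpl; ring.
- intros i j <-; rewrite plus_INR; cbn [pochhammer]; ring.
Qed.

(** Saalschutz's theorem cleared of denominators.  Pascal's rule expresses the
    sum of order [k + 1] through the same sum of order [k] and through a sum that
    absorption identifies with the one of order [k - 1] at [B + 1], [C + 1],
    [D + 1]; the induction hypothesis evaluates both. *)
Lemma saalschutz (n : nat) : forall B C D : R, 0 < D ->
  bsum n (fun i j => pochhammer (D - B) i * pochhammer (D - C) i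
                     * pochhammer (D + INR i) j * pochhammer (B + C - D) j) =
  pochhammer B n * pochhammer C n.
Proof.
induction n as [n IH] using (well_founded_induction Wf_nat.lt_wf).
intros B C D hD; destruct n as [|k]; [simpl; ring|].
set (t := fun i j => pochhammer (D - B) i * pochhammer (D - C) i
                     * pochhammer (D + INR i) j * pochhammer (B + C - D) j).
set (r := fun i j => pochhammer (D - B) i * pochhammer (D - C) i
                     * pochhammer (D + 1 + INR i) j * pochhammer (B + C - D) (S j)).
assert (h : bsum (S k) t = ((B + INR k) * (C + INR k) - INR k * (B + C - D)) * bsum k t
              + B * C * bsum k (fun i j => INR j * r i (pred j))).
{ cbn [bsum]; rewrite <- !bsum_scal, <- !bsum_plus.
  apply bsum_ext; intros i j hij; unfold t, r.
  replace (D + INR (S i)) with (D + 1 + INR i) by (rewrite S_INR; ring).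
  destruct j as [|j]; cbn [pred].
  - replace k with i by lia; cbn [pochhammer]; simpl (INR 0); ring.
  - rewrite (poch_S_l (D + INR i) (S j)), (poch_S_l (D + INR i) j).
    replace (D + INR i + 1) with (D + 1 + INR i) by ring.
    subst k; rewrite plus_INR, S_INR; cbn [pochhammer]; rewrite S_INR; ring. }
assert (ht : bsum k t = pochhammer B k * pochhammer C k) by (apply IH; lia || lra).
rewrite h, ht.
destruct k as [|k].
- simpl; ring.
- rewrite bsum_absorb_r.
  (* Raising B, C and D by one keeps the differences with D and raises
     B + C - D by one. *)
  assert (hr : bsum k r = (B + C - D) * (pochhammer (B + 1) k * pochhammer (C + 1) k)).
  { rewrite <- (IH k ltac:(lia) (B + 1) (C + 1) (D + 1) ltac:(lra)), <- bsum_scal.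
    apply bsum_ext; intros i j _; unfold r; rewrite poch_S_l.
    replace (D + 1 - (B + 1)) with (D - B) by ring.
    replace (D + 1 - (C + 1)) with (D - C) by ring.
    replace (B + 1 + (C + 1) - (D + 1)) with (B + C - D + 1) by ring.
    ring. }
  rewrite hr; change (pochhammer ?x (S (S k))) with (pochhammer x (S k) * (x + INR (S k))).
  rewrite (poch_S_l B k), (poch_S_l C k); ring.
Qed.

(** * Inversion *)

(** Equal to [(m + 2n - 1) (m)_{n-1}] for [n >= 1] and to [1] for [n = 0]; the
    form as a sum makes both cases one expression, also when [m = 1]. *)
Definition weight (m : R) (n : nat) : R :=
  pochhammer m n + INR n * pochhammer m (pred n).

Lemma weight_pos (m : R) (n : nat) : 0 < m -> 0 < weight m n.
Proof.
intros hm; unfold weight.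
pose proof (poch_pos m n hm); pose proof (poch_pos m (pred n) hm).
pose proof (Rmult_le_pos _ _ (pos_INR n) (Rlt_le _ _ H0)); lra.
Qed.

Lemma weight_S (m : R) (n : nat) :
  weight m (S n) = pochhammer m n * (m + 2 * INR n + 1).
Proof. unfold weight; cbn [pochhammer pred]; rewrite S_INR; ring. Qed.

Lemma weight_shift (m : R) (k i : nat) :
  weight m (k + i) * pochhammer (m + INR (k + i) - 1) k =
  pochhammer m (2 * k) * weight (m + 2 * INR k) i.
Proof.
destruct k as [|k].
- simpl (2 * 0)%nat; simpl (INR 0); rewrite Nat.add_0_l.
  replace (m + 2 * 0) with m by ring; simpl pochhammer; ring.
- assert (hi : pochhammer m (S (2 * k + 1)) * weight (m + 2 * INR (S k)) i
    = pochhammer m (k + i + k + 1) * (m + 2 * INR (k + i) + 1)).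
  { destruct i as [|i].
    - rewrite Nat.add_0_r; replace (k + k + 1)%nat with (2 * k + 1)%nat by lia.
      cbn [pochhammer]; unfold weight; rewrite plus_INR, mult_INR; simpl; ring.
    - rewrite weight_S; replace (k + S i + k + 1)%nat with (S (2 * k + 1) + i)%nat by lia.
      rewrite poch_add.
      replace (m + 2 * INR (S k)) with (m + INR (S (2 * k + 1)))
        by (rewrite !S_INR, plus_INR, mult_INR; simpl; ring).
      rewrite plus_INR, !S_INR, plus_INR, mult_INR; simpl; ring. }
  replace (2 * S k)%nat with (S (2 * k + 1)) by lia.
  rewrite hi; replace (S k + i)%nat with (S (k + i)) by lia.
  rewrite weight_S, <- Nat.add_assoc, Nat.add_1_r, (poch_add m (k + i) (S k)).
  replace (m + INR (S (k + i)) - 1) with (m + INR (k + i)) by (rewrite S_INR; ring).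
  ring.
Qed.

(** The orthogonality behind the inversion: by Pascal's rule and absorption the
    sum is a difference of two equal sums, the discrete counterpart of a
    telescoping series. *)
Lemma weight_telescope (m : R) (q : nat) :
  bsum (S q) (fun i j => weight m i
     * ((-1) ^ j * pochhammer (m + INR i + INR (S q)) j)) = 0.
Proof.
set (p := fun i j => (-1) ^ j * pochhammer (m + INR i + INR (S q) + 1) j).
cbn [bsum]; rewrite <- bsum_plus.
rewrite (bsum_ext q _ (fun i j =>
  INR i * (pochhammer m (pred i) * p (pred i) (S j))
  + (-1) * (INR j * (pochhammer m i * p i (S (pred j)))))).
- rewrite bsum_plus, bsum_scal.
  destruct q as [|q]; [simpl; ring|].
  rewrite (bsum_absorb_l q (fun i j => pochhammer m i * p i (S j))).
  rewrite (bsum_absorb_r q (fun i j => pochhammer m i * p i (S j))); ring.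
- intros i j hij; unfold p; rewrite weight_S; unfold weight.
  replace (m + INR (S i) + INR (S q)) with (m + INR i + INR (S q) + 1)
    by (rewrite (S_INR i); ring).
  rewrite (poch_S_l (m + INR i + INR (S q)) j).
  assert (hi : INR i * (pochhammer m (pred i) * ((-1) ^ S j
      * pochhammer (m + INR (pred i) + INR (S q) + 1) (S j)))
    = INR i * (pochhammer m (pred i) * ((-1) ^ S j
      * ((m + INR i + INR (S q)) * pochhammer (m + INR i + INR (S q) + 1) j)))).
  { destruct i as [|i]; [simpl; ring|]; cbn [pred].
    replace (m + INR i + INR (S q) + 1) with (m + INR (S i) + INR (S q))
      by (rewrite (S_INR i); ring).
    now rewrite (poch_S_l (m + INR (S i) + INR (S q)) j). }
  rewrite hi.
  assert (hj : INR j * (pochhammer m i * ((-1) ^ S (pred j)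
      * pochhammer (m + INR i + INR (S q) + 1) (S (pred j))))
    = INR j * (pochhammer m i * ((-1) ^ j
      * pochhammer (m + INR i + INR (S q) + 1) j))).
  { destruct j; [simpl; ring|easy]. }
  rewrite hj.
  rewrite (S_INR q), <- hij, plus_INR; cbn [pow]; ring.
Qed.

(** After the exchange of summations, the factor of [E k] is the sum of
    [weight_telescope] with [m + 2k] in place of [m] and order [K - k], so only
    [k = K] survives. *)
Lemma weight_inversion (m : R) (E : nat -> R) (K : nat) :
  bsum K (fun n r =>
    weight m n
    * bsum n (fun k _ => (-1) ^ k * pochhammer (m + INR n - 1) k * E k)
    * ((-1) ^ r * pochhammer (m + INR n + INR K) r)) =
  (-1) ^ K * pochhammer m (2 * K) * E K.
Proof.
rewrite (bsum_ext K _ (fun n r => bsum n (fun k i =>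
  (-1) ^ k * E k * pochhammer m (2 * k) * (weight (m + 2 * INR k) i
  * ((-1) ^ r * pochhammer (m + 2 * INR k + INR i + INR (i + r)) r))))).
- rewrite (bsum_assoc K (fun k i r =>
    (-1) ^ k * E k * pochhammer m (2 * k) * (weight (m + 2 * INR k) i
    * ((-1) ^ r * pochhammer (m + 2 * INR k + INR i + INR (i + r)) r)))).
  rewrite bsum_last.
  + simpl bsum; unfold weight; simpl; ring.
  + intros k s; rewrite bsum_scal.
    rewrite (bsum_ext (S s) _ (fun i r => weight (m + 2 * INR k) i
      * ((-1) ^ r * pochhammer (m + 2 * INR k + INR i + INR (S s)) r)))
      by (intros i r <-; easy).
    rewrite weight_telescope; ring.
- intros n r <-.
  rewrite (Rmult_comm (weight m n)), Rmult_assoc, Rmult_comm, <- bsum_scal.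
  apply bsum_ext; intros k i <-.
  replace (m + INR (k + i) + INR (k + i + r))
    with (m + 2 * INR k + INR i + INR (i + r)) by (rewrite !plus_INR; ring).
  transitivity ((weight m (k + i) * pochhammer (m + INR (k + i) - 1) k)
    * ((-1) ^ k * E k * ((-1) ^ r
       * pochhammer (m + 2 * INR k + INR i + INR (i + r)) r))); [ring|].
  rewrite weight_shift; ring.
Qed.

(** * Whipple's transformation *)

(** The terminating series [4F3(-n, n+2mu-1, mu+1/2, a; mu, b, c; 1)]. *)
Definition square_coef (a b c mu : R) (n : nat) : R :=
  bsum n (fun k _ => (-1) ^ k * pochhammer (2 * mu + INR n - 1) k
    * (pochhammer (mu + 1 / 2) k * pochhammer a k
       / (pochhammer mu k * pochhammer b k * pochhammer c k))).

Definition growth (a b c mu : R) (j : nat) : R :=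
  pochhammer (b - a) j * pochhammer (c - a) j / pochhammer mu j.

Definition sign_sum (a b c mu : R) (n : nat) : R :=
  bsum n (fun i j => pochhammer (- 1 / 2) i * (pochhammer a i / pochhammer mu i)
                     * growth a b c mu j).

(** The condition on [mu] says that the [4F3] series is balanced.  Saalschutz's
    theorem expands the factor [(n+2mu-1)_k (mu+1/2)_k / (mu)_k]; after exchanging
    the summations, the inner sum is again of Saalschutz's form because the series
    is balanced. *)
Lemma square_coef_whipple (a b c mu : R) (n : nat) :
  0 < b -> 0 < c -> 0 < mu -> 2 * mu = b + c - a - 1 / 2 ->
  square_coef a b c mu n =
  pochhammer mu n / (pochhammer b n * pochhammer c n)
  * sign_sum a b c mu n.
Proof.
intros hb hc hmu hm.
pose proof (fun k => Rgt_not_eq _ _ (poch_pos b k hb)) as nb.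
pose proof (fun k => Rgt_not_eq _ _ (poch_pos c k hc)) as nc.
pose proof (fun k => Rgt_not_eq _ _ (poch_pos mu k hmu)) as nmu.
set (B := 2 * mu + INR n - 1); set (s := 2 * mu + INR n - 1 / 2).
set (P := fun i => pochhammer (mu - B) i * pochhammer (- 1 / 2) i
                   * pochhammer a i / pochhammer mu i).
set (Q := fun i j r => pochhammer (a + INR i) j * pochhammer s j
  * pochhammer (b + INR i + INR j) r * pochhammer (1 - c - INR n) r).
unfold square_coef, sign_sum; fold B.
rewrite (bsum_ext n _ (fun k r => bsum k (fun i j =>
  / (pochhammer b n * pochhammer c n)
  * ((-1) ^ i * P i * ((-1) ^ (j + r) * Q i j r))))).
2:{ intros k r hkr.
  assert (h : pochhammer B k * pochhammer (mu + 1 / 2) k / pochhammer mu k =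
    bsum k (fun i j => pochhammer (mu - B) i * pochhammer (- 1 / 2) i
                        * pochhammer s j / pochhammer mu i)).
  { rewrite <- (saalschutz k B (mu + 1 / 2) mu hmu).
    unfold Rdiv at 1; rewrite Rmult_comm, <- bsum_scal.
    apply bsum_ext; intros i j <-.
    replace (mu - (mu + 1 / 2)) with (- 1 / 2) by field.
    replace (B + (mu + 1 / 2) - mu) with s by (unfold B, s; field).
    rewrite poch_add.
    assert (pochhammer (mu + INR i) j <> 0).
    { apply Rgt_not_eq, poch_pos; pose proof (pos_INR i); lra. }
    field; auto. }
  transitivity ((-1) ^ k * (pochhammer a k / (pochhammer b k * pochhammer c k))
    * (pochhammer B k * pochhammer (mu + 1 / 2) k / pochhammer mu k));
    [field; auto|].
  rewrite h, <- bsum_scal; apply bsum_ext; intros i j hij; unfold P, Q.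
  replace (1 - c - INR n) with (1 - (c + INR k) - INR r)
    by (rewrite <- hkr, plus_INR; ring).
  replace (b + INR i + INR j) with (b + INR k) by (rewrite <- hij, plus_INR; ring).
  rewrite poch_reflect, <- hkr, (poch_add b k r), (poch_add c k r).
  replace (pochhammer a k) with (pochhammer a i * pochhammer (a + INR i) j)
    by (rewrite <- poch_add, hij; easy).
  replace ((-1) ^ k) with ((-1) ^ i * (-1) ^ j) by (rewrite <- pow_add, hij; easy).
  assert (pochhammer (b + INR k) r <> 0).
  { apply Rgt_not_eq, poch_pos; pose proof (pos_INR k); lra. }
  assert (pochhammer (c + INR k) r <> 0).
  { apply Rgt_not_eq, poch_pos; pose proof (pos_INR k); lra. }
  assert (hr : (-1) ^ (j + r) * (-1) ^ r = (-1) ^ j).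
  { rewrite pow_add, Rmult_assoc, <- Rpow_mult_distr.
    replace (-1 * -1) with 1 by ring; rewrite pow1; ring. }
  rewrite <- hr; field; auto. }
rewrite (bsum_assoc n (fun i j r => / (pochhammer b n * pochhammer c n)
  * ((-1) ^ i * P i * ((-1) ^ (j + r) * Q i j r)))).
rewrite <- bsum_scal; apply bsum_ext; intros i t hit.
(* The sum over j is a reflected instance of the same theorem. *)
transitivity (/ (pochhammer b n * pochhammer c n) * ((-1) ^ i * P i
  * ((-1) ^ t * bsum t (Q i)))).
{ rewrite <- !bsum_scal; apply bsum_ext; intros j r <-; ring. }
assert (hQ : bsum t (Q i) = pochhammer (b - a) t * pochhammer (1 - (c - a) - INR t) t).
{ assert (hbi : 0 < b + INR i) by (pose proof (pos_INR i); lra).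
  replace (1 - (c - a) - INR t) with (b + INR i - s)
    by (unfold s; rewrite <- hit, plus_INR; lra).
  rewrite <- (saalschutz t _ _ _ hbi); apply bsum_ext; intros j r _; unfold Q.
  replace (b + INR i - (b - a)) with (a + INR i) by ring.
  replace (b + INR i - (b + INR i - s)) with s by ring.
  now replace (b - a + (b + INR i - s) - (b + INR i)) with (1 - c - INR n)
    by (unfold s; lra). }
rewrite hQ, poch_reflect; unfold P, growth.
replace (mu - B) with (1 - (mu + INR t) - INR i)
  by (unfold B; rewrite <- hit, plus_INR; ring).
rewrite poch_reflect.
replace (pochhammer mu n) with (pochhammer mu t * pochhammer (mu + INR t) i)
  by (rewrite <- poch_add, <- hit; f_equal; lia).
assert (h1 : forall k, (-1) ^ k * (-1) ^ k = 1).
{ intros k; rewrite <- Rpow_mult_distr; replace (-1 * -1) with 1 by ring; apply pow1. }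
transitivity (((-1) ^ i * (-1) ^ i) * ((-1) ^ t * (-1) ^ t) *
  (/ (pochhammer b n * pochhammer c n) * (pochhammer (mu + INR t) i
   * pochhammer (- 1 / 2) i * pochhammer a i / pochhammer mu i
   * (pochhammer (b - a) t * pochhammer (c - a) t)))); [field; auto|].
rewrite !h1; field; auto.
Qed.

(** * Positivity of the coefficients *)

Lemma growth_ratio (a b c mu : R) (j : nat) :
  0 < mu ->
  growth a b c mu (S j) * (mu + INR j) =
  growth a b c mu j * ((b - a + INR j) * (c - a + INR j)).
Proof.
intros hmu; unfold growth; cbn [pochhammer].
pose proof (Rgt_not_eq _ _ (poch_pos mu j hmu)); pose proof (pos_INR j).
field; split; lra.
Qed.

Lemma growth_pos (a b c mu : R) (j : nat) :
  a < b -> a < c -> 0 < mu -> 0 < growth a b c mu j.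
Proof.
intros hb hc hmu; unfold growth.
apply Rdiv_lt_0_compat; [apply Rmult_lt_0_compat|]; apply poch_pos; lra.
Qed.

(** The ratio of consecutive values of [growth] at [n] is
    [(b-a+n) (c-a+n) / (mu+n)].  It is at least [n + 1/2], the ratio for [(1/2)_n],
    as soon as [n >= 1/2]; this excludes [n = 0], which is why the comparison
    starts at [S j]. *)
Lemma half_growth (a b c mu : R) (j i : nat) :
  0 < a -> a < b -> a < c -> a <= mu -> 2 * mu = b + c - a - 1 / 2 ->
  a / 2 <= (b - a) * (c - a) ->
  growth a b c mu (S j) * pochhammer (1 / 2) (S j + i)
  <= growth a b c mu (S j + i) * pochhammer (1 / 2) (S j).
Proof.
intros ha hb hc hmu hm hp; induction i as [|i IH].
- rewrite Nat.add_0_r; lra.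
- rewrite Nat.add_succ_r; set (n := (S j + i)%nat) in *.
  assert (hn : 1 <= INR n) by (unfold n; rewrite plus_INR, S_INR;
    pose proof (pos_INR j); pose proof (pos_INR i); lra).
  pose proof (growth_ratio a b c mu n ltac:(lra)) as hr.
  pose proof (growth_pos a b c mu n hb hc ltac:(lra)) as hg.
  pose proof (poch_pos (1 / 2) (S j) ltac:(lra)) as hh.
  assert (hk : (1 / 2 + INR n) * (mu + INR n) <= (b - a + INR n) * (c - a + INR n))
    by nra.
  apply Rmult_le_reg_r with (mu + INR n); [lra|].
  transitivity (growth a b c mu n * pochhammer (1 / 2) (S j)
                * ((1 / 2 + INR n) * (mu + INR n))).
  + change (pochhammer (1 / 2) (S n)) with (pochhammer (1 / 2) n * (1 / 2 + INR n)).
    apply (Rmult_le_compat_r ((1 / 2 + INR n) * (mu + INR n))) in IH; [lra|].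
    apply Rmult_le_pos; lra.
  + replace (growth a b c mu (S n) * pochhammer (1 / 2) (S j) * (mu + INR n))
      with (growth a b c mu (S n) * (mu + INR n) * pochhammer (1 / 2) (S j)) by ring.
    rewrite hr.
    apply (Rmult_le_compat_l (growth a b c mu n * pochhammer (1 / 2) (S j))) in hk;
      [lra|apply Rmult_le_pos; lra].
Qed.

(** Starting from [0] the comparison loses the factor [a / mu], since
    [growth 1 >= (a / mu) * (1 / 2)]. *)
Lemma half_growth_1 (a b c mu : R) (n : nat) :
  0 < a -> a < b -> a < c -> a <= mu -> 2 * mu = b + c - a - 1 / 2 ->
  a / 2 <= (b - a) * (c - a) ->
  a / mu * pochhammer (1 / 2) (S n) <= growth a b c mu (S n).
Proof.
intros ha hb hc hmu hm hp.
pose proof (half_growth a b c mu 0 n ha hb hc hmu hm hp) as h.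
pose proof (growth_ratio a b c mu 0 ltac:(lra)) as hr.
pose proof (poch_pos (1 / 2) (S n) ltac:(lra)) as hh.
assert (h1 : a / mu * (1 / 2) <= growth a b c mu 1).
{ apply Rmult_le_reg_r with mu; [lra|].
  replace (a / mu * (1 / 2) * mu) with (a / 2) by (field; lra).
  simpl INR in hr; rewrite !Rplus_0_r in hr; rewrite hr.
  unfold growth; simpl; lra. }
change (1 + n)%nat with (S n) in h.
change (pochhammer (1 / 2) 1) with (1 * (1 / 2 + 0)) in h.
apply (Rmult_le_compat_r _ _ _ (Rlt_le _ _ hh)) in h1; lra.
Qed.

Lemma poch_ratio_le (a mu : R) (i : nat) :
  0 < a -> a <= mu -> pochhammer a (S i) / pochhammer mu (S i) <= a / mu.
Proof.
intros ha hmu.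
rewrite !poch_S_l.
pose proof (poch_pos (mu + 1) i ltac:(lra)) as h1.
pose proof (poch_le (a + 1) (mu + 1) i ltac:(lra) ltac:(lra)) as h2.
apply Rmult_le_reg_r with (mu * pochhammer (mu + 1) i);
  [apply Rmult_lt_0_compat; lra|].
transitivity (a * pochhammer (a + 1) i); [right; field; split; lra|].
transitivity (a * pochhammer (mu + 1) i); [|right; field; lra].
apply Rmult_le_compat_l; lra.
Qed.

Lemma poch_neg_half (i : nat) : pochhammer (- 1 / 2) (S i) <= 0.
Proof.
rewrite poch_S_l; replace (- 1 / 2 + 1) with (1 / 2) by field.
pose proof (poch_pos (1 / 2) i ltac:(lra)); lra.
Qed.

(** The terms with [i >= 1] are negative, and in proportion to the term [i = 0] each
    of them is at most as large in absolute value as in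
    [sum C(n,i) (-1/2)_i (1/2)_{n-i} = (0)_n = 0].  At [i = n], where [growth] only
    satisfies [half_growth_1], the factor [(a)_n / (mu)_n <= a / mu] compensates. *)
Lemma sign_sum_nonneg (a b c mu : R) (n : nat) :
  0 < a -> a < b -> a < c -> a <= mu -> 2 * mu = b + c - a - 1 / 2 ->
  a / 2 <= (b - a) * (c - a) -> 0 <= sign_sum a b c mu n.
Proof.
intros ha hb hc hmu hm hp; destruct n as [|n].
- unfold sign_sum, growth; simpl; lra.
- pose proof (poch_pos (1 / 2) (S n) ltac:(lra)) as hh.
  apply Rmult_le_reg_l with (pochhammer (1 / 2) (S n)); [easy|].
  rewrite Rmult_0_r; unfold sign_sum; rewrite <- bsum_scal.
  transitivity (growth a b c mu (S n) * bsum (S n) (fun i j =>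
    pochhammer (- 1 / 2) i * pochhammer (1 / 2) j)).
  { rewrite vandermonde, poch_S_l; lra. }
  rewrite <- bsum_scal; apply bsum_le; intros [|i] j hij.
  { replace j with (S n) by lia; right; simpl; field. }
  pose proof (poch_neg_half i) as hs.
  pose proof (poch_ratio_le a mu i ha hmu) as hr.
  enough (h : pochhammer a (S i) / pochhammer mu (S i)
    * (growth a b c mu j * pochhammer (1 / 2) (S n))
    <= growth a b c mu (S n) * pochhammer (1 / 2) j)
    by (apply (Rmult_le_compat_neg_l _ _ _ hs) in h; lra).
  destruct j as [|j].
  + transitivity (a / mu * pochhammer (1 / 2) (S n)).
    * replace (growth a b c mu 0) with 1 by (unfold growth; simpl; field).
      rewrite Rmult_1_l; apply Rmult_le_compat_r; lra.
    * simpl (pochhammer (1 / 2) 0); rewrite Rmult_1_r; now apply half_growth_1.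
  + transitivity (1 * (growth a b c mu (S j) * pochhammer (1 / 2) (S n))).
    * apply Rmult_le_compat_r.
      { pose proof (growth_pos a b c mu (S j) hb hc ltac:(lra)).
        apply Rmult_le_pos; lra. }
      apply Rle_trans with (1 := hr), Rmult_le_reg_r with mu; [lra|].
      replace (a / mu * mu) with a by (field; lra); lra.
    * rewrite Rmult_1_l; replace (S n) with (S j + S i)%nat by lia.
      now apply half_growth.
Qed.

Lemma sign_sum_1 (a b c mu : R) :
  0 < mu -> sign_sum a b c mu 1 = ((b - a) * (c - a) - a / 2) / mu.
Proof. intros hmu; unfold sign_sum, growth; simpl; field; lra. Qed.

(** This serves the boundary [(b - a) (c - a) = a / 2], where [sign_sum 1]
    vanishes. *)
Lemma sign_sum_2 (a b c mu : R) :
  0 < a -> a < b -> a < c -> a < mu -> 2 * mu = b + c - a - 1 / 2 ->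
  a / 2 <= (b - a) * (c - a) -> 0 < sign_sum a b c mu 2.
Proof.
intros ha hb hc hmu hm hp.
set (p := (b - a) * (c - a)) in *.
assert (h : sign_sum a b c mu 2 =
  (p * (p + (2 * mu - a + 3 / 2)) - p * (a + a / mu) - a * (a + 1) / 4)
  / (mu * (mu + 1))).
{ replace (2 * mu - a + 3 / 2) with (b - a + (c - a) + 1) by lra.
  unfold sign_sum, growth, p; simpl; field; lra. }
rewrite h; apply Rdiv_lt_0_compat; [|apply Rmult_lt_0_compat; lra].
assert (a / mu <= 1).
{ apply Rmult_le_reg_r with mu; [lra|]; replace (a / mu * mu) with a by (field; lra); lra. }
nra.
Qed.

(** The terms of [sign_sum] other than the first are nonpositive, and the first one
    contributes [(b-a)_n (c-a)_n / ((b)_n (c)_n)] to [square_coef]. *)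
Lemma square_coef_le_1 (a b c mu : R) (n : nat) :
  0 < a -> a < b -> a < c -> 0 < mu -> 2 * mu = b + c - a - 1 / 2 ->
  square_coef a b c mu n <= 1.
Proof.
intros ha hb hc hmu hm.
rewrite square_coef_whipple by lra.
pose proof (poch_pos b n ltac:(lra)) as pb.
pose proof (poch_pos c n ltac:(lra)) as pc.
pose proof (poch_pos mu n hmu) as pmu.
transitivity (pochhammer mu n / (pochhammer b n * pochhammer c n) * growth a b c mu n).
- apply Rmult_le_compat_l.
  { apply Rlt_le, Rdiv_lt_0_compat; [easy|now apply Rmult_lt_0_compat]. }
  etransitivity; [apply bsum_le_first|right; simpl; field].
  intros i j; pose proof (poch_neg_half i).
  pose proof (growth_pos a b c mu j hb hc hmu).
  assert (0 < pochhammer a (S i) / pochhammer mu (S i))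
    by (apply Rdiv_lt_0_compat; apply poch_pos; lra).
  rewrite Rmult_assoc; apply Rmult_le_0_r; [easy|].
  apply Rmult_le_pos; lra.
- unfold growth.
  replace (pochhammer mu n / (pochhammer b n * pochhammer c n) *
    (pochhammer (b - a) n * pochhammer (c - a) n / pochhammer mu n))
    with (pochhammer (b - a) n * pochhammer (c - a) n
          / (pochhammer b n * pochhammer c n)) by (field; lra).
  apply Rle_div_l; [now apply Rmult_lt_0_compat|]; rewrite Rmult_1_l.
  pose proof (poch_pos (b - a) n ltac:(lra)); pose proof (poch_pos (c - a) n ltac:(lra)).
  apply Rmult_le_compat; try lra; apply poch_le; lra.
Qed.

(** * Squares of Bessel functions *)

(** The coefficients of [0F1(; t; -y)], which up to a power of [y] and a constant
    is the Bessel function of order [t - 1] at [2 sqrt y]. *)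
Definition bessel_coef (t : R) (k : nat) : R :=
  (-1) ^ k / (INR (fact k) * pochhammer t k).

Definition bessel (t y : R) : R := PSeries (bessel_coef t) y.

Lemma bessel_coef_neq_0 (t : R) (k : nat) : 0 < t -> bessel_coef t k <> 0.
Proof.
intros ht; pose proof (INR_fact_lt_0 k); pose proof (poch_pos t k ht).
apply Rmult_integral_contrapositive_currified; [apply pow_nonzero; lra|].
apply Rinv_neq_0_compat, Rgt_not_eq, Rmult_lt_0_compat; easy.
Qed.

Lemma abs_bessel_coef (t : R) (k : nat) :
  0 < t -> Rabs (bessel_coef t k) = / (INR (fact k) * pochhammer t k).
Proof.
intros ht; unfold bessel_coef, Rdiv.
pose proof (INR_fact_lt_0 k); pose proof (poch_pos t k ht).
rewrite Rabs_mult, pow_1_abs, Rmult_1_l.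
apply Rabs_pos_eq, Rlt_le, Rinv_0_lt_compat, Rmult_lt_0_compat; easy.
Qed.

Lemma bessel_coef_le (t y : R) (k : nat) :
  0 < t -> 0 <= y -> Rabs (bessel_coef t k * y ^ k) <= / INR (fact k) * (y / t) ^ k.
Proof.
intros ht hy.
pose proof (INR_fact_lt_0 k) as hf; pose proof (poch_pos t k ht) as hp.
pose proof (pow_lt t k ht) as htk.
rewrite Rabs_mult, abs_bessel_coef by easy.
rewrite (Rabs_pos_eq (y ^ k)) by now apply pow_le.
unfold Rdiv; rewrite Rpow_mult_distr, pow_inv, Rinv_mult.
rewrite Rmult_assoc, (Rmult_comm (/ pochhammer t k)).
apply Rmult_le_compat_l; [apply Rlt_le, Rinv_0_lt_compat; easy|].
apply Rmult_le_compat_l; [now apply pow_le|].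
apply Rinv_le_contravar; [easy|now apply pow_le_poch].
Qed.

Lemma bessel_CV_radius (t : R) : 0 < t -> CV_radius (bessel_coef t) = p_infty.
Proof.
intros ht; apply CV_radius_infinite_DAlembert.
- intros k; now apply bessel_coef_neq_0.
- apply is_lim_seq_le_le with (u := fun _ => 0) (w := fun k => / t * / INR (S k)).
  + intros k; split; [apply Rabs_pos|].
    pose proof (INR_fact_lt_0 k); pose proof (poch_pos t k ht).
    pose proof (pos_INR k).
    rewrite Rabs_div by now apply bessel_coef_neq_0.
    rewrite !abs_bessel_coef, fact_simpl, mult_INR, S_INR by easy; cbn [pochhammer].
    replace (_ / _) with (/ (t + INR k) * / (INR k + 1)) by (field; lra).
    apply Rmult_le_compat_r; [apply Rlt_le, Rinv_0_lt_compat; lra|].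
    apply Rinv_le_contravar; lra.
  + apply is_lim_seq_const.
  + replace (Finite 0) with (Rbar_mult (/ t) 0) by (simpl; f_equal; ring).
    apply is_lim_seq_scal_l, (is_lim_seq_incr_1 (fun n => / INR n)).
    replace (Finite 0) with (Rbar_inv p_infty) by easy.
    apply is_lim_seq_inv; [apply is_lim_seq_INR|easy].
Qed.

Lemma is_pseries_bessel (t y : R) :
  0 < t -> is_pseries (bessel_coef t) y (bessel t y).
Proof.
intros ht; apply PSeries_correct, CV_radius_inside.
rewrite (bessel_CV_radius t ht); easy.
Qed.

Definition bessel_sq_coef (t : R) (j : nat) : R :=
  (-1) ^ j * pochhammer (2 * t - 1 + INR j) j / (INR (fact j) * pochhammer t j ^ 2).

(** Neumann's formula for the square of a Bessel function.  Reflecting the rising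
    factorials in the denominators turns the Cauchy product into Vandermonde's
    sum. *)
Lemma PS_mult_bessel_coef (t : R) (n : nat) :
  0 < t -> PS_mult (bessel_coef t) (bessel_coef t) n = bessel_sq_coef t n.
Proof.
intros ht; unfold PS_mult, bessel_coef, bessel_sq_coef.
pose proof (fun k => Rgt_not_eq _ _ (poch_pos t k ht)) as np.
pose proof (fun k => not_0_INR _ (fact_neq_0 k)) as nf.
rewrite (sum_eq _ (fun k => (fun i j =>
    pochhammer (1 - t - INR n) i * pochhammer (1 - t - INR n) j) k (n - k)%nat
    / (INR (fact k) * INR (fact (n - k))) * / pochhammer t n ^ 2)).
- rewrite <- scal_sum, (sum_bsum n (fun i j =>
    pochhammer (1 - t - INR n) i * pochhammer (1 - t - INR n) j)), vandermonde.
  replace (1 - t - INR n + (1 - t - INR n)) with (1 - (2 * t - 1 + INR n) - INR n)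
    by ring.
  rewrite poch_reflect; field; auto.
- intros i hi; cbv beta; set (j := (n - i)%nat).
  assert (hij : INR n = INR i + INR j) by (unfold j; rewrite minus_INR by easy; ring).
  replace (1 - t - INR n) with (1 - (t + INR j) - INR i) at 1 by lra.
  replace (1 - t - INR n) with (1 - (t + INR i) - INR j) by lra.
  rewrite !poch_reflect.
  pose proof (poch_add t i j) as h1; pose proof (poch_add t j i) as h2.
  replace (i + j)%nat with n in h1 by (unfold j; lia).
  replace (j + i)%nat with n in h2 by (unfold j; lia).
  replace (pochhammer t n ^ 2) with (pochhammer t n * pochhammer t n) by ring.
  pose proof (np n); rewrite h1 at 1; rewrite h2.
  rewrite h1 in H; apply Rmult_neq_0_reg in H as [_ H].
  pose proof (np n) as H'; rewrite h2 in H'; apply Rmult_neq_0_reg in H' as [_ H'].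
  field; repeat split; auto.
Qed.

Lemma is_pseries_bessel_sq (t y : R) :
  0 < t -> is_pseries (bessel_sq_coef t) y (bessel t y ^ 2).
Proof.
intros ht.
assert (hr : Rbar_lt (Rabs y) (CV_radius (bessel_coef t)))
  by (rewrite (bessel_CV_radius t ht); easy).
pose proof (is_pseries_mult _ _ _ _ _ (is_pseries_bessel t y ht)
  (is_pseries_bessel t y ht) hr hr) as h.
replace (bessel t y ^ 2) with (bessel t y * bessel t y) by ring.
revert h; apply is_pseries_ext; intros n; now apply PS_mult_bessel_coef.
Qed.

Lemma bessel_contiguous (t y : R) :
  0 < t -> bessel t y - bessel (t + 1) y = - (y / (t * (t + 1))) * bessel (t + 2) y.
Proof.
intros ht.
pose proof (is_pseries_bessel t y ht) as h0.
pose proof (is_pseries_bessel (t + 1) y ltac:(lra)) as h1.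
pose proof (is_pseries_bessel (t + 2) y ltac:(lra)) as h2.
assert (hc : forall k, bessel_coef t k - bessel_coef (t + 1) k =
  - / (t * (t + 1)) * match k with O => 0 | S p => bessel_coef (t + 2) p end).
{ intros [|k]; unfold bessel_coef; [simpl; field; lra|].
  rewrite (poch_S_l t k).
  change (pochhammer (t + 1) (S k)) with (pochhammer (t + 1) k * (t + 1 + INR k)).
  replace (t + 2) with (t + 1 + 1) by ring.
  pose proof (poch_S_l (t + 1) k) as hs; cbn [pochhammer] in hs.
  pose proof (poch_pos (t + 1) k ltac:(lra)); pose proof (pos_INR k).
  pose proof (INR_fact_lt_0 k).
  replace (pochhammer (t + 1 + 1) k)
    with (pochhammer (t + 1) k * (t + 1 + INR k) / (t + 1))
    by (rewrite hs; field; lra).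
  rewrite fact_simpl, mult_INR, S_INR; cbn [pow].
  field; lra. }
pose proof (is_series_minus _ _ _ _ (proj1 (is_pseries_R _ _ _) h0)
              (proj1 (is_pseries_R _ _ _) h1)) as h.
apply is_pseries_incr_1, is_pseries_R, (is_series_scal (- / (t * (t + 1)))) in h2.
apply is_series_unique in h; apply is_series_unique in h2.
etransitivity; [symmetry; exact h|].
transitivity (scal (- / (t * (t + 1))) (scal y (bessel (t + 2) y))).
- etransitivity; [|exact h2]; apply Series_ext; intros n.
  unfold minus, plus, opp, scal; simpl; unfold mult; simpl.
  transitivity ((bessel_coef t n - bessel_coef (t + 1) n) * y ^ n); [ring|].
  rewrite hc; destruct n; simpl; unfold zero; simpl; ring.
- unfold scal; simpl; unfold mult; simpl; field; lra.
Qed.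

(** The series of [bessel t y + exp (y / t)] in powers of [y] has nonnegative terms
    and constant term [2]. *)
Lemma bessel_pos_large (t y : R) : 0 < y -> y / ln 2 < t -> 0 < bessel t y.
Proof.
intros hy hty.
assert (hl : 0 < ln 2) by (rewrite <- ln_1; apply ln_increasing; lra).
assert (ht : 0 < t).
{ apply Rlt_trans with (2 := hty), Rdiv_lt_0_compat; easy. }
assert (he : exp (y / t) < 2).
{ rewrite <- (exp_ln 2) by lra; apply exp_increasing.
  apply Rlt_div_l; [easy|]; rewrite Rmult_comm; now apply Rlt_div_l. }
pose proof (is_pseries_plus _ _ _ _ _ (is_pseries_bessel t y ht)
              (is_pseries_bessel t y ht)) as h.
enough (h2 : 2 <= bessel t y + exp (y / t)) by lra.
pose proof (proj1 (is_pseries_R _ _ _) (is_pseries_bessel t y ht)) as hb.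
pose proof (proj1 (is_pseries_R _ _ _) (is_exp_Reals (y / t))) as hx.
pose proof (is_series_plus _ _ _ _ hb hx) as hs.
apply is_series_Reals in hs.
apply (sum_incr _ 0) in hs.
- revert hs; simpl; unfold plus, bessel_coef; simpl.
  intros hs; eapply Rle_trans; [|exact hs]; right; field.
- intros k; unfold plus; simpl.
  pose proof (bessel_coef_le t y k ht (Rlt_le _ _ hy)) as hk.
  apply Rabs_le_between in hk; lra.
Qed.

(** By the contiguous relation a common zero would propagate to all
    [bessel (t + n)], against positivity for large [n]. *)
Lemma bessel_no_common_zero (t y : R) :
  0 < t -> 0 < y -> bessel t y = 0 -> bessel (t + 1) y <> 0.
Proof.
intros ht hy h0 h1.
assert (h : forall n, bessel (t + INR n) y = 0 /\ bessel (t + INR n + 1) y = 0).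
{ induction n as [|n [IH0 IH1]]; [simpl; now rewrite Rplus_0_r|].
  replace (t + INR (S n)) with (t + INR n + 1) by (rewrite S_INR; ring).
  split; [easy|].
  pose proof (pos_INR n).
  pose proof (bessel_contiguous (t + INR n) y ltac:(lra)) as hc.
  rewrite IH0, IH1 in hc.
  replace (t + INR n + 1 + 1) with (t + INR n + 2) by ring.
  symmetry in hc; rewrite Rminus_0_r in hc.
  apply Rmult_integral in hc as [hc|hc]; [|easy].
  assert (0 < y / ((t + INR n) * (t + INR n + 1)))
    by (apply Rdiv_lt_0_compat; [easy|apply Rmult_lt_0_compat; lra]).
  lra. }
destruct (INR_unbounded (y / ln 2)) as [n hn].
pose proof (bessel_pos_large (t + INR n) y hy ltac:(lra)).
destruct (h n); lra.
Qed.

(** * Summing the expansion *)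

Lemma is_series_sum (g : nat -> nat -> R) (s : nat -> R) (N : nat) :
  (forall n, is_series (g n) (s n)) ->
  is_series (fun K => sum_f_R0 (fun n => g n K) N) (sum_f_R0 s N).
Proof.
intros hs; induction N as [|N IH]; simpl; [apply hs|].
now apply (is_series_plus (V := R_NormedModule)).
Qed.

Lemma sum_triangular (f : nat -> R) (K N : nat) :
  (K <= N)%nat -> (forall n, (K < n)%nat -> f n = 0) -> sum_f_R0 f N = sum_f_R0 f K.
Proof.
intros hKN hf; induction hKN as [|N hKN IH]; [easy|].
simpl; rewrite IH, hf by lia; ring.
Qed.

Lemma partial_sums_diff_le (f : nat -> R) (N K : nat) :
  (N <= K)%nat ->
  sum_f_R0 f N - sum_f_R0 f K <= sum_f_R0 (fun n => Rabs (f n)) K.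
Proof.
intros hNK.
assert (h0 : 0 <= sum_f_R0 (fun n => Rabs (f n)) N)
  by (apply cond_pos_sum; intros; apply Rabs_pos).
induction hNK as [|K hNK IH]; [lra|].
simpl; pose proof (Rle_abs (- f (S K))); rewrite Rabs_Ropp in H; lra.
Qed.

(** An exchange of summations, reduced to one inequality.  For
    [M >= N] the diagonal sum and the sum of the rows up to [M] agree in the columns
    up to [M] and differ by at most [B K] in the column [K > M]; the tail of [B]
    tends to [0]. *)
Lemma sum_le_triangular_Series (g : nat -> nat -> R) (s B : nat -> R) (N : nat) :
  (forall n, is_series (g n) (s n)) ->
  (forall n K, (K < n)%nat -> g n K = 0) ->
  (forall K, sum_f_R0 (fun n => Rabs (g n K)) K <= B K) ->
  ex_series B -> (forall n, 0 <= s n) ->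
  sum_f_R0 s N <= Series (fun K => sum_f_R0 (fun n => g n K) K).
Proof.
intros hs htri hB exB hpos.
set (d := fun K => sum_f_R0 (fun n => g n K) K).
assert (exd : ex_series d).
{ apply (ex_series_le (V := R_CompleteNormedModule)) with B; [|easy].
  intros K; eapply Rle_trans; [apply Rsum_abs|apply hB]. }
destruct exB as [lB hlB]; destruct exd as [ld hld].
rewrite (is_series_unique d ld hld).
assert (h : forall M, (N <= M)%nat -> sum_f_R0 B M <= lB + ld - sum_f_R0 s N).
{ intros M hNM.
  (* The column sums of B + d - g are nonnegative and equal B up to M, so the
     partial sum of B is at most the total. *)
  pose proof (is_series_minus _ _ _ _ (is_series_plus _ _ _ _ hlB hld)
                (is_series_sum g s M hs)) as hd.
  apply is_series_Reals in hd.
  apply (sum_incr _ M) in hd.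
  - assert (hM : sum_f_R0 s N <= sum_f_R0 s M).
    { clear -hNM hpos; induction hNM as [|M hNM IH]; [lra|].
      simpl; specialize (hpos (S M)); lra. }
    revert hd; unfold minus, plus, opp; simpl; intros hd.
    rewrite (sum_eq _ B) in hd; [lra|].
    intros K hK; unfold d.
    rewrite (sum_triangular (fun n => g n K) K M hK) by (intros; now apply htri); ring.
  - intros K; unfold minus, plus, opp, d; simpl.
    destruct (Nat.le_ge_cases K M) as [hKM|hMK].
    + rewrite (sum_triangular (fun n => g n K) K M hKM) by (intros; now apply htri).
      specialize (hB K); pose proof (cond_pos_sum (fun n => Rabs (g n K)) K
        (fun n => Rabs_pos _)); lra.
    + specialize (hB K); pose proof (partial_sums_diff_le (fun n => g n K) M K hMK); lra. }
assert (hl : Rbar_le lB (lB + ld - sum_f_R0 s N)).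
{ apply is_lim_seq_le with (u := fun M => sum_f_R0 B (M + N))
    (v := fun _ => lB + ld - sum_f_R0 s N).
  - intros M; apply h; lia.
  - apply is_lim_seq_incr_n with (u := sum_f_R0 B).
    apply is_lim_seq_Reals; now apply is_series_Reals.
  - apply is_lim_seq_const. }
simpl in hl; lra.
Qed.

(** * The expansion *)

Definition square_weight (a b c mu : R) (n : nat) : R :=
  weight (2 * mu) n * square_coef a b c mu n
  / (INR (fact n) * pochhammer (mu + 1 / 2) n ^ 2).

(** The Taylor coefficients in [y] of the [n]-th square of the expansion, multiplied
    by its weight; the shift accounts for the factor [y^n]. *)
Definition expansion_coef (a b c mu : R) (n : nat) : nat -> R :=
  PS_incr_n (fun j => square_weight a b c mu n
                      * bessel_sq_coef (mu + 1 / 2 + INR n) j) n.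

(** What remains of the Taylor coefficient of [y^K] when the factor
    [1 / (n! j! (mu+1/2)_K^2)] is removed; the factorials belong to the binomial
    coefficient of [bsum] and the other factor does not depend on [n]. *)
Definition expansion_numerator (a b c mu : R) (K n j : nat) : R :=
  weight (2 * mu) n * square_coef a b c mu n
  * ((-1) ^ j * pochhammer (2 * mu + INR n + INR K) j).

Lemma expansion_coef_eq (a b c mu : R) (n K : nat) :
  0 < mu -> (n <= K)%nat ->
  expansion_coef a b c mu n K =
  expansion_numerator a b c mu K n (K - n) / (INR (fact n) * INR (fact (K - n)))
  * / pochhammer (mu + 1 / 2) K ^ 2.
Proof.
intros hmu hn; unfold expansion_coef; rewrite PS_incr_n_simplify.
destruct (Compare_dec.le_lt_dec n K) as [_|hn']; [|lia].
unfold square_weight, bessel_sq_coef, expansion_numerator; set (j := (K - n)%nat).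
replace K with (n + j)%nat by (unfold j; lia).
rewrite (poch_add _ n j), plus_INR.
replace (2 * (mu + 1 / 2 + INR n) - 1 + INR j)
  with (2 * mu + INR n + (INR n + INR j)) by field.
pose proof (INR_fact_lt_0 n); pose proof (INR_fact_lt_0 j); pose proof (pos_INR n).
pose proof (poch_pos (mu + 1 / 2) n ltac:(lra)).
pose proof (poch_pos (mu + 1 / 2 + INR n) j ltac:(lra)).
field; lra.
Qed.

Lemma expansion_coef_eq_0 (a b c mu : R) (n K : nat) :
  (K < n)%nat -> expansion_coef a b c mu n K = 0.
Proof.
intros hn; unfold expansion_coef; rewrite PS_incr_n_simplify.
destruct (Compare_dec.le_lt_dec n K); [lia|easy].
Qed.

Lemma is_series_expansion (a b c mu y : R) (n : nat) :
  0 < mu ->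
  is_series (fun K => expansion_coef a b c mu n K * y ^ K)
    (square_weight a b c mu n * (y ^ n * bessel (mu + 1 / 2 + INR n) y ^ 2)).
Proof.
intros hmu; apply is_pseries_R; unfold expansion_coef.
pose proof (pos_INR n).
pose proof (is_pseries_bessel_sq (mu + 1 / 2 + INR n) y ltac:(lra)) as h.
apply (is_pseries_scal (square_weight a b c mu n)) in h; [|apply Rmult_comm].
apply (is_pseries_incr_n _ n) in h.
rewrite pow_n_pow in h; revert h; unfold scal; simpl; unfold mult; simpl.
intros h; eapply is_series_ext in h; [|intros k; reflexivity].
replace (square_weight a b c mu n * (y ^ n * (bessel (mu + 1 / 2 + INR n) y *
  (bessel (mu + 1 / 2 + INR n) y * 1)))) with (y ^ n * (square_weight a b c mu n *
  (bessel (mu + 1 / 2 + INR n) y * (bessel (mu + 1 / 2 + INR n) y * 1)))) by ring.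
exact h.
Qed.

Lemma sum_expansion_coef (a b c mu : R) (K : nat) :
  0 < mu -> 0 < b -> 0 < c ->
  sum_f_R0 (fun n => expansion_coef a b c mu n K) K =
  pochhammer a K / (INR (fact K) * pochhammer b K * pochhammer c K) * (- 4) ^ K.
Proof.
intros hmu hb hc.
rewrite (sum_eq _ (fun n => expansion_numerator a b c mu K n (K - n)
  / (INR (fact n) * INR (fact (K - n))) * / pochhammer (mu + 1 / 2) K ^ 2))
  by (intros; now apply expansion_coef_eq).
rewrite <- scal_sum, (sum_bsum K (expansion_numerator a b c mu K)).
unfold expansion_numerator, square_coef.
rewrite (weight_inversion (2 * mu)), poch_duplication.
replace ((- 4) ^ K) with ((-1) ^ K * 4 ^ K)
  by (rewrite <- Rpow_mult_distr; f_equal; ring).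
pose proof (INR_fact_lt_0 K).
pose proof (poch_pos (mu + 1 / 2) K ltac:(lra)).
pose proof (poch_pos mu K hmu); pose proof (poch_pos b K hb); pose proof (poch_pos c K hc).
field; lra.
Qed.

Lemma weight_le (m : R) (n : nat) : 0 < m -> weight m n <= (2 + / m) * pochhammer m n.
Proof.
intros hm; pose proof (Rinv_0_lt_compat m hm).
destruct n as [|n]; [unfold weight; simpl; lra|].
rewrite weight_S; cbn [pochhammer]; pose proof (poch_pos m n hm); pose proof (pos_INR n).
replace ((2 + / m) * (pochhammer m n * (m + INR n)))
  with (pochhammer m n * (2 * m + 2 * INR n + 1 + INR n * / m)) by (field; lra).
apply Rmult_le_compat_l; [lra|].
pose proof (Rmult_le_pos _ _ H1 (Rlt_le _ _ H)); lra.
Qed.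

Lemma poch_ge_const (m : R) (n : nat) : 0 < m -> 1 <= (1 + / m) * pochhammer m n.
Proof.
intros hm; pose proof (Rinv_0_lt_compat m hm); destruct n as [|n]; [simpl; lra|].
rewrite poch_S_l, <- Rmult_assoc.
replace ((1 + / m) * m) with (m + 1) by (field; lra).
pose proof (pow_le_poch 1 n ltac:(lra)) as h1; rewrite pow1 in h1.
pose proof (poch_le 1 (m + 1) n ltac:(lra) ltac:(lra)).
transitivity (1 * 1); [lra|apply Rmult_le_compat; lra].
Qed.

(** Up to constants [weight] is at most [(m)_n] and [(m+n)_K] at least [1], where
    [m = 2 mu].  The product [(m)_n (m+n)_K (m+n+K)_j] is [(m)_{2K}], which the
    duplication formula bounds by [4^K (mu+1/2)_K^2]. *)
Lemma expansion_numerator_le (a b c mu : R) (K n j : nat) :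
  0 < mu -> (n + j = K)%nat -> 0 <= square_coef a b c mu n <= 1 ->
  Rabs (expansion_numerator a b c mu K n j) <=
  (2 + / (2 * mu)) * (1 + / (2 * mu)) * 4 ^ K * pochhammer (mu + 1 / 2) K ^ 2.
Proof.
intros hmu hK hC; set (m := 2 * mu); assert (hm : 0 < m) by (unfold m; lra).
pose proof (Rinv_0_lt_compat m hm) as him.
pose proof (pos_INR n) as hn; pose proof (pos_INR K) as hKp.
pose proof (weight_pos m n hm) as hw; pose proof (weight_le m n hm) as hwl.
pose proof (poch_pos m n hm) as hpn.
pose proof (poch_pos (m + INR n + INR K) j ltac:(lra)) as hpj.
unfold expansion_numerator; fold m.
rewrite !Rabs_mult, pow_1_abs, Rmult_1_l, !Rabs_pos_eq by lra.
transitivity ((2 + / m) * (pochhammer m n * pochhammer (m + INR n + INR K) j)).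
{ rewrite <- Rmult_assoc; apply Rmult_le_compat_r; [lra|].
  rewrite <- (Rmult_1_r ((2 + / m) * _)); apply Rmult_le_compat; lra. }
rewrite !Rmult_assoc; apply Rmult_le_compat_l; [lra|].
transitivity (((1 + / m) * pochhammer (m + INR n) K)
  * (pochhammer m n * pochhammer (m + INR n + INR K) j)).
{ rewrite <- (Rmult_1_l (pochhammer m n * _)) at 1; apply Rmult_le_compat_r.
  - apply Rmult_le_pos; lra.
  - apply Rle_trans with (1 := poch_ge_const m K hm).
    apply Rmult_le_compat_l; [lra|apply poch_le; lra]. }
replace (_ * pochhammer (m + INR n) K * _) with ((1 + / m) * pochhammer m (2 * K)).
2:{ replace (2 * K)%nat with (n + K + j)%nat by lia.
    rewrite (poch_add m (n + K)), (poch_add m n), plus_INR, <- Rplus_assoc; ring. }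
apply Rmult_le_compat_l; [lra|].
unfold m; rewrite poch_duplication, Rmult_assoc.
apply Rmult_le_compat_l; [apply pow_le; lra|].
pose proof (poch_pos mu K hmu); pose proof (poch_le mu (mu + 1 / 2) K hmu ltac:(lra)).
simpl; rewrite Rmult_1_r; apply Rmult_le_compat_r; lra.
Qed.

Lemma sum_abs_expansion_coef (a b c mu : R) (K : nat) :
  0 < mu -> (forall n, 0 <= square_coef a b c mu n <= 1) ->
  sum_f_R0 (fun n => Rabs (expansion_coef a b c mu n K)) K <=
  (2 + / (2 * mu)) * (1 + / (2 * mu)) * (/ INR (fact K) * 8 ^ K).
Proof.
intros hmu hC.
pose proof (INR_fact_lt_0 K).
pose proof (poch_pos (mu + 1 / 2) K ltac:(lra)) as hp.
set (M := (2 + / (2 * mu)) * (1 + / (2 * mu))).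
rewrite (sum_eq _ (fun n => (fun n j => Rabs (expansion_numerator a b c mu K n j))
    n (K - n)%nat / (INR (fact n) * INR (fact (K - n))) * / pochhammer (mu + 1 / 2) K ^ 2)).
2:{ intros n hn; rewrite expansion_coef_eq by easy.
    pose proof (INR_fact_lt_0 n); pose proof (INR_fact_lt_0 (K - n)).
    unfold Rdiv; rewrite !Rabs_mult.
    rewrite (Rabs_pos_eq (/ (_ * _)))
      by (apply Rlt_le, Rinv_0_lt_compat, Rmult_lt_0_compat; easy).
    rewrite (Rabs_pos_eq (/ _ ^ 2)); [easy|].
    apply Rlt_le, Rinv_0_lt_compat, pow_lt; easy. }
rewrite <- scal_sum, (sum_bsum K (fun n j => Rabs (expansion_numerator a b c mu K n j))).
transitivity (/ pochhammer (mu + 1 / 2) K ^ 2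
  * ((M * 4 ^ K * pochhammer (mu + 1 / 2) K ^ 2) * 2 ^ K / INR (fact K))).
- apply Rmult_le_compat_l; [apply Rlt_le, Rinv_0_lt_compat, pow_lt; easy|].
  apply Rmult_le_compat_r; [apply Rlt_le, Rinv_0_lt_compat; easy|].
  rewrite <- bsum_1, <- bsum_scal; apply bsum_le; intros n j hnj.
  rewrite Rmult_1_r; now apply expansion_numerator_le.
- right; replace (8 ^ K) with (4 ^ K * 2 ^ K)
    by (rewrite <- Rpow_mult_distr; f_equal; ring).
  field; lra.
Qed.

Lemma square_coef_nonneg (a b c mu : R) (n : nat) :
  0 < a -> a < b -> a < c -> a <= mu -> 2 * mu = b + c - a - 1 / 2 ->
  a / 2 <= (b - a) * (c - a) -> 0 <= square_coef a b c mu n.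
Proof.
intros ha hb hc hmu hm hp; rewrite square_coef_whipple by lra.
pose proof (poch_pos b n ltac:(lra)); pose proof (poch_pos c n ltac:(lra)).
pose proof (poch_pos mu n ltac:(lra)).
apply Rmult_le_pos; [|now apply sign_sum_nonneg].
apply Rlt_le, Rdiv_lt_0_compat; [easy|now apply Rmult_lt_0_compat].
Qed.

Lemma square_weight_pos (a b c mu : R) (n : nat) :
  0 < b -> 0 < c -> 0 < mu -> 2 * mu = b + c - a - 1 / 2 ->
  0 < sign_sum a b c mu n -> 0 < square_weight a b c mu n.
Proof.
intros hb hc hmu hm hs; unfold square_weight; rewrite square_coef_whipple by lra.
pose proof (poch_pos b n hb); pose proof (poch_pos c n hc); pose proof (poch_pos mu n hmu).
pose proof (weight_pos (2 * mu) n ltac:(lra)); pose proof (INR_fact_lt_0 n).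
apply Rdiv_lt_0_compat.
- apply Rmult_lt_0_compat, Rmult_lt_0_compat, hs; [easy|].
  apply Rdiv_lt_0_compat; [easy|now apply Rmult_lt_0_compat].
- apply Rmult_lt_0_compat; [easy|apply pow_lt, poch_pos; lra].
Qed.

Lemma square_term_nonneg (a b c mu y : R) (n : nat) :
  0 < a -> a < b -> a < c -> a <= mu -> 2 * mu = b + c - a - 1 / 2 ->
  a / 2 <= (b - a) * (c - a) -> 0 <= y ->
  0 <= square_weight a b c mu n * (y ^ n * bessel (mu + 1 / 2 + INR n) y ^ 2).
Proof.
intros ha hb hc hmu hm hp hy; apply Rmult_le_pos.
- pose proof (weight_pos (2 * mu) n ltac:(lra)); pose proof (INR_fact_lt_0 n).
  pose proof (square_coef_nonneg a b c mu n ha hb hc hmu hm hp).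
  apply Rdiv_le_0_compat; [apply Rmult_le_pos; lra|].
  apply Rmult_lt_0_compat; [easy|apply pow_lt, poch_pos; lra].
- apply Rmult_le_pos; [now apply pow_le|apply pow2_ge_0].
Qed.

(** Each [C_n] lies in [[0, 1]], so the double series is dominated by a multiple of
    the exponential series of [8 y] and its rows are nonnegative. *)
Lemma sum_squares_le_Phi (a b c mu x : R) (N : nat) :
  0 < a -> a < b -> a < c -> a <= mu -> 2 * mu = b + c - a - 1 / 2 ->
  a / 2 <= (b - a) * (c - a) ->
  sum_f_R0 (fun n => square_weight a b c mu n
    * ((x ^ 2 / 16) ^ n * bessel (mu + 1 / 2 + INR n) (x ^ 2 / 16) ^ 2)) N
  <= Phi a b c x.
Proof.
intros ha hb hc hmu hm hp; set (y := x ^ 2 / 16).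
assert (hy : 0 <= y) by (unfold y; pose proof (pow2_ge_0 x); lra).
set (M := (2 + / (2 * mu)) * (1 + / (2 * mu))).
transitivity (Series (fun K => sum_f_R0 (fun n =>
  expansion_coef a b c mu n K * y ^ K) K)).
- apply sum_le_triangular_Series with (B := fun K => M * (/ INR (fact K) * (8 * y) ^ K)).
  + intros n; apply is_series_expansion; lra.
  + intros n K hn; rewrite expansion_coef_eq_0 by easy; ring.
  + intros K; rewrite (sum_eq _ (fun n => Rabs (expansion_coef a b c mu n K) * y ^ K)).
    2:{ intros n _; rewrite Rabs_mult, (Rabs_pos_eq (y ^ K)); [easy|now apply pow_le]. }
    rewrite <- scal_sum, Rpow_mult_distr, Rmult_comm, <- !Rmult_assoc.
    apply Rmult_le_compat_r; [now apply pow_le|].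
    rewrite Rmult_assoc; apply sum_abs_expansion_coef; [lra|intros n; split].
    * now apply square_coef_nonneg.
    * apply square_coef_le_1; lra.
  + apply (ex_series_scal (V := R_NormedModule) M (fun K => / INR (fact K) * (8 * y) ^ K)).
    exists (exp (8 * y)); apply is_pseries_R, is_exp_Reals.
  + intros n; now apply square_term_nonneg.
- right; apply Series_ext; intros K.
  rewrite <- scal_sum, sum_expansion_coef by lra.
  replace (- (x ^ 2 / 4)) with (-4 * y) by (unfold y; field).
  rewrite Rpow_mult_distr; ring.
Qed.

Theorem theorem4p2 (a b c : R) (ha : 0 < a) (hb : 0 < b) (hc : 0 < c)
  (hP : P_star a (b, c)) (hL : ~ Lambda a (b, c)) :
  forall x : R, 0 < x -> 0 < Phi a b c x.
Proof.
intros x hx; destruct hP as (_ & _ & hab & hac & hmax).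
assert (h1 : 3 * a + 1 / 2 - b <= c)
  by (apply Rge_le in hmax; apply Rle_trans with (2 := hmax), Rmax_l).
assert (h2 : a + a / (2 * (b - a)) <= c)
  by (apply Rge_le in hmax; apply Rle_trans with (2 := hmax), Rmax_r).
assert (hp : a / 2 <= (b - a) * (c - a)).
{ apply Rmult_le_compat_l with (r := b - a) in h2; [|lra].
  replace ((b - a) * (a + a / (2 * (b - a)))) with ((b - a) * a + a / 2) in h2
    by (field; lra).
  lra. }
set (mu := (b + c - a - 1 / 2) / 2).
assert (hm : 2 * mu = b + c - a - 1 / 2) by (unfold mu; field).
assert (hmu : a <= mu) by (unfold mu; lra).
clearbody mu.
set (y := x ^ 2 / 16); set (t := mu + 1 / 2).
assert (hy : 0 < y) by (pose proof (pow_lt x 2 hx); unfold y; lra).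
assert (ht : 0 < t) by (unfold t; lra).
pose proof (sum_squares_le_Phi a b c mu x 2 ha hab hac hmu hm hp) as hsum.
fold y t in hsum; apply Rlt_le_trans with (2 := hsum).
cbn [sum_f_R0].
pose proof (fun n => square_term_nonneg a b c mu y n ha hab hac hmu hm hp
                       (Rlt_le _ _ hy)) as hn; fold t in hn.
assert (hpos : forall n, 0 < sign_sum a b c mu n -> bessel (t + INR n) y <> 0 ->
  0 < square_weight a b c mu n * (y ^ n * bessel (t + INR n) y ^ 2)).
{ intros n hs hn0; apply Rmult_lt_0_compat.
  - apply square_weight_pos; lra.
  - apply Rmult_lt_0_compat; [now apply pow_lt|now apply pow2_gt_0]. }
pose proof (hn 0%nat) as n0; pose proof (hn 1%nat) as n1; pose proof (hn 2%nat) as n2.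
destruct (Req_dec (bessel t y) 0) as [hz|hz].
2:{ pose proof (hpos 0%nat) as p0; simpl (INR 0) in p0; rewrite Rplus_0_r in p0.
    assert (0 < sign_sum a b c mu 0) by (unfold sign_sum, growth; simpl; lra).
    simpl (INR 0) in *; rewrite Rplus_0_r in *; specialize (p0 H hz); lra. }
pose proof (bessel_no_common_zero t y ht hy hz) as hz1.
destruct (Rle_lt_or_eq_dec _ _ hp) as [hlt|heq].
- pose proof (hpos 1%nat) as p1.
  rewrite sign_sum_1 in p1 by lra.
  assert (0 < ((b - a) * (c - a) - a / 2) / mu) by (apply Rdiv_lt_0_compat; lra).
  specialize (p1 H hz1); lra.
(* Now (b - a) (c - a) = a / 2, and mu = a would put (b, c) in Lambda. *)
- assert (hmu' : a < mu).
  { destruct (Rle_lt_or_eq_dec _ _ hmu) as [h|h]; [easy|exfalso; apply hL].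
    assert (h0 : (b - a - a) * (b - a - 1 / 2) = 0) by nra.
    apply Rmult_integral in h0 as [h0|h0]; [right|left]; f_equal; lra. }
  pose proof (sign_sum_2 a b c mu ha hab hac hmu' hm hp) as hs.
  assert (hz2 : bessel (t + INR 2) y <> 0).
  { intros hz2; simpl (INR 2) in hz2; replace (t + (1 + 1)) with (t + 2) in hz2 by ring.
    pose proof (bessel_contiguous t y ht) as hc2; rewrite hz, hz2 in hc2; lra. }
  specialize (hpos 2%nat hs hz2); lra.
Qed.
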